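(* Let $n\ge0$, let $F$ be a field and $\xi\in F$, suppose $M>0$, and let $\mathcal K_n$ be one of $\mathcal P_n$, $\mathcal B_n$, $\mathcal{PB}_n$. Then $$e^\xi(\mathcal K_n)=\sum_{\mu\vdash n}e^\xi_\mu(\mathcal K_n).$$ If $\mu\vdash n$ and $k=h(\mu)$, then $$e^\xi_\mu(\mathcal K_n)=\sum_{\substack{0\le r\le n\\ r\equiv k\ (\mathrm{mod}\ M)}}e_\mu(D_r(\mathcal K_n)).$$
   Context: Write $\mathbf n=\{1,\dots,n\}$ and let $\mathbf n'$ be a disjoint copy. $\mathcal P_n$ is the monoid of all set partitions $\alpha$ (into non-empty blocks) of $\mathbf n\cup\mathbf n'$. Product: for $\alpha,\beta\in\mathcal P_n$ take a third copy $\mathbf n''$; relabel each lower vertex $x'$ of $\alpha$ as $x''$ and each upper vertex $x$ of $\beta$ as $x''$, and take the union graph $\Gamma(\alpha,\beta)$ on $\mathbf n\cup\mathbf n'\cup\mathbf n''$ (a partition being represented by a graph whose connected components are its blocks); $x,y\in\mathbf n\cup\mathbf n'$ are in the same block of $\alpha\beta$ iff they are joined by a path in $\Gamma(\alpha,\beta)$. $\mathcal{PB}_n$ is the submonoid of partitions all of whose blocks have size at most $2$, and $\mathcal B_n$ the submonoid of partitions all of whose blocks have size exactly $2$. The partition algebra $\mathcal P_n^\xi$ is the $F$-algebra with basis $\mathcal P_n$ and product given on basis elements by $\alpha\circ\beta=\xi^{m(\alpha,\beta)}(\alpha\beta)$, where $m(\alpha,\beta)$ is the number of connected components of $\Gamma(\alpha,\beta)$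 entirely contained in $\mathbf n''$ (with $\xi^0=1$). $M=m$ if $\xi$ is a root of unity of order $m$ (least $m\ge1$ with $\xi^m=1$) and $m\le n$; otherwise $M=0$. The rank of $\alpha$ is the number of blocks meeting both $\mathbf n$ and $\mathbf n'$; $D_r(\mathcal K_n)=\{\alpha\in\mathcal K_n:\operatorname{rank}(\alpha)=r\}$. $\ker^\wedge(\alpha)$ (resp. $\ker_\vee(\alpha)$) is the equivalence on $\mathbf n$ relating $x,y$ iff $x,y$ (resp. $x',y'$) are in the same block of $\alpha$; the kernel-classes of $\alpha$ are the classes of $\ker(\alpha)=\ker^\wedge(\alpha)\vee\ker_\vee(\alpha)$, the smallest equivalence containing both. $\mu(\alpha)$ is the integer partition of $n$ whose parts are the sizes of the kernel-classes of $\alpha$. $e^\xi(\mathcal K_n)$ is the number of $\alpha\in\mathcal K_n$ with $\alpha\circ\alpha=\alpha$; $e^\xi_\mu(\mathcal K_n)$ is the number of $\alpha\in\mathcal K_n$ with $\alpha\circ\alpha=\alpha$ and $\mu(\alpha)=\mu$; for $\Sigma\subseteq\mathcal P_n$, $e_\mu(\Sigma)$ is the number of $\alpha\in\Sigma$ with $\alpha^2=\alpha$ (product in $\mathcal P_n$) and $\mu(\alpha)=\mu$. For an integer partition $\mu=(m_1,\dots,m_k)\vdash n$, $h(\mu)=k$ is its number of parts. *)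

(* Defs.v *)
From HB Require Import structures.
From mathcomp Require Import all_boot all_order all_algebra.

Set Implicit Arguments.
Unset Strict Implicit.
Unset Printing Implicit Defensive.

Import GRing.Theory.

(* [inl x] is the upper vertex x, [inr x] the lower vertex x'; the elements of
   {1, ..., n} are represented by 'I_n = {0, ..., n - 1}. *)
Notation vertex n := ('I_n + 'I_n)%type.

Record diagram (n : nat) := Diagram {
  blocks :> {set {set vertex n}};
  diagramP : partition blocks [set: vertex n]
}.
HB.instance Definition _ n := [isSub for @blocks n].
HB.instance Definition _ n := [Finite of diagram n by <:].

Definition same_block n (a : diagram n) : rel (vertex n) :=
  fun u v => v \in pblock a u.

(* [inl u] is the outer vertex u, [inr x] the middle vertex x''. *)
Notation gvertex n := (vertex n + 'I_n)%type.

Definition left_emb n (u : vertex n) : gvertex n :=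
  match u with inl x => inl (inl x) | inr x => inr x end.
Definition right_emb n (u : vertex n) : gvertex n :=
  match u with inl x => inr x | inr x => inl (inr x) end.

(* Each block is drawn as a complete graph (with loops); the connected
   components of the union do not depend on how blocks are drawn. *)
Definition Gamma n (a b : diagram n) : rel (gvertex n) := fun p q =>
  [exists u, exists v,
     [&& p == left_emb u, q == left_emb v & same_block a u v]
  || [&& p == right_emb u, q == right_emb v & same_block b u v]].

Lemma same_block_sym n (a : diagram n) : symmetric (same_block a).
Proof.
move=> u v; have /and3P [/eqP cov tri _] := diagramP a.
have inC w : w \in cover a by rewrite cov inE.
by rewrite /same_block -!eq_pblock // eq_sym.
Qed.

Lemma Gamma_sym n (a b : diagram n) : symmetric (Gamma a b).
Proof.
move=> p q; apply/existsP/existsP => -[u /existsP [v H]]; exists v;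
  apply/existsP; exists u; case/orP: H => /and3P [-> -> H];
  by rewrite !(same_block_sym _ v u) H ?orbT.
Qed.

Definition prod_rel n (a b : diagram n) : rel (vertex n) :=
  fun u v => connect (Gamma a b) (inl u) (inl v).

Lemma prod_subproof n (a b : diagram n) :
  partition (equivalence_partition (prod_rel a b) [set: vertex n])
            [set: vertex n].
Proof.
apply/equivalence_partitionP => u v w _ _ _; split=> [|uv].
  exact: connect0.
exact: (same_connect (sym_connect_sym (Gamma_sym a b))) uv _.
Qed.

Definition dprod n (a b : diagram n) : diagram n :=
  Diagram (prod_subproof a b).

Definition floating n (a b : diagram n) : nat :=
  #|[set C in equivalence_partition (connect (Gamma a b)) [set: gvertex n]
     | C \subset [set inr x | x : 'I_n]]|.

Definition partial_brauer (n : nat) : {set diagram n} :=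
  [set a : diagram n | [forall B in blocks a, #|B| <= 2]].

Definition brauer (n : nat) : {set diagram n} :=
  [set a : diagram n | [forall B in blocks a, #|B| == 2]].

Definition rank n (a : diagram n) : nat :=
  #|[set B in blocks a | [exists x, inl x \in B] && [exists x, inr x \in B]]|.

Definition rank_class n (r : nat) (K : {set diagram n}) : {set diagram n} :=
  [set a in K | rank a == r].

Definition ker_up n (a : diagram n) : rel 'I_n :=
  fun x y => same_block a (inl x) (inl y).
Definition ker_low n (a : diagram n) : rel 'I_n :=
  fun x y => same_block a (inr x) (inr y).

(* As both relations are equivalences, the reflexive-transitive closure of
   their union is their join. *)
Definition ker n (a : diagram n) : rel 'I_n :=
  connect (relU (ker_up a) (ker_low a)).

Definition kernel_classes n (a : diagram n) : {set {set 'I_n}} :=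
  equivalence_partition (ker a) [set: 'I_n].

(* Integer partitions are non-increasing sequences of positive parts. *)
Definition is_intpart (n : nat) (s : seq nat) : bool :=
  [&& sorted geq s, 0 \notin s & sumn s == n].

(* A partition of n has at most n parts, each at most n. *)
Definition intparts (n : nat) : seq (seq nat) :=
  [seq s <- [seq map val (bseqval t) | t : n.-bseq 'I_n.+1] | is_intpart n s].

Lemma intparts_uniq n : uniq (intparts n).
Proof.
rewrite filter_uniq // map_inj_uniq ?enum_uniq // => s t st.
by apply/val_inj/(inj_map val_inj).
Qed.

Lemma mem_intparts n s : (s \in intparts n) = is_intpart n s.
Proof.
rewrite mem_filter; case: (boolP (is_intpart n s)) => //=.
case/and3P=> _ s0 /eqP sn.
have size_le : size s <= n.
  rewrite -sn; elim: s s0 {sn} => //= x s IH.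
  rewrite inE negb_or eq_sym -lt0n => /andP [x0 /IH le_s].
  by rewrite -add1n leq_add.
have s_le x : x \in s -> x < n.+1.
  rewrite ltnS -sn; elim: s {s0 sn size_le} => //= y s IH.
  by rewrite inE => /orP [/eqP -> | /IH le_x];
    rewrite ?leq_addr // (leq_trans le_x) ?leq_addl.
have tP : size (map (@inord n) s) <= n by rewrite size_map.
apply/imageP; exists (Bseq tP) => //=.
rewrite -map_comp -[LHS]map_id; apply/eq_in_map => x /s_le x_lt /=.
by rewrite inordK.
Qed.

Definition kernel_type n (a : diagram n) : seq nat :=
  sort geq [seq #|C : {set 'I_n}| | C <- enum (kernel_classes a)].

Definition e_type n (mu : seq nat) (S : {set diagram n}) : nat :=
  #|[set a in S | (dprod a a == a) && (kernel_type a == mu)]|.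

Section PartitionAlgebra.
Local Open Scope ring_scope.
Variables (F : fieldType) (n : nat) (xi : F).

(* The free F-module on diagrams; [F^o] is F as a module over itself. *)
Local Notation palg := {ffun diagram n -> F^o}.

Definition pbasis (a : diagram n) : palg := [ffun b => (b == a)%:R].

(* Bilinear extension of the twisted product of basis elements. *)
Definition pmul (f g : palg) : palg :=
  \sum_a \sum_b (f a * g b * xi ^+ floating a b) *: pbasis (dprod a b).

Lemma pmul_basis a b :
  pmul (pbasis a) (pbasis b) = xi ^+ floating a b *: pbasis (dprod a b).
Proof.
rewrite /pmul (bigD1 a) //= [X in _ + X]big1 ?addr0; last first.
  by move=> c ca; apply: big1 => d _; rewrite ffunE (negPf ca) !mul0r scale0r.
rewrite (bigD1 b) //= [X in _ + X]big1 ?addr0; last first.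
  by move=> d db; rewrite !ffunE (negPf db) mulr0 mul0r scale0r.
by rewrite !ffunE !eqxx !mul1r.
Qed.

Definition e_xi (K : {set diagram n}) : nat :=
  #|[set a in K | pmul (pbasis a) (pbasis a) == pbasis a]|.

Definition e_xi_type (mu : seq nat) (K : {set diagram n}) : nat :=
  #|[set a in K | (pmul (pbasis a) (pbasis a) == pbasis a)
                  && (kernel_type a == mu)]|.

(* [m.-primitive_root xi] says that m is the least m >= 1 with xi ^+ m = 1. *)
Definition twist_order : nat :=
  if [pick m : 'I_n.+1 | m.-primitive_root xi] is Some m then m else 0%N.

End PartitionAlgebra.

(* Main.v *)
Require Import Defs.
From mathcomp Require Import all_boot all_order all_algebra.

(** A basis diagram satisfies [pmul a a = a] exactly when it is idempotent in
    the partition monoid and [xi ^+ floating a a = 1], that is, when the order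
    of [xi] divides [floating a a].  The theorem therefore reduces to the
    identity

      rank a + floating a a = number of kernel classes of a

    for every idempotent diagram [a] ([rank_add_floating]): the order of [xi]
    divides [floating a a] if and only if the rank of [a] is congruent, modulo
    this order, to the number of parts of [kernel_type a].  Both formulas then
    follow by sorting the diagrams counted on the left by kernel type and by
    rank ([card_sum_fibres]).

    In the product graph of [a] with itself, the middle row carries the lower
    pattern of [a] (left factor) and the upper pattern of [a] (right factor),
    and a detour through an outer vertex never joins new middle vertices: it
    enters and leaves inside a single block.  So the trace on the middle row of
    the connected components is the set of kernel classes ([connect_middle]),
    and a component floats exactly when its kernel class meets no transversal
    block on either side.

    If [a] is idempotent, then the upper and lower parts of a transversal block
    lie in one kernel class ([idem_transversal_ker]), and a kernel class contains
    at most one transversal block ([idem_transversal_uniq]).  Hence transversal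
    blocks correspond bijectively to the kernel classes that do not float. *)

Set Implicit Arguments.
Unset Strict Implicit.
Unset Printing Implicit Defensive.

Import GRing.Theory.

(** * Blocks and kernel classes *)

Lemma mem_equivalence_classes (T : finType) (R : rel T) (D : {set T}) :
  reflect (exists x, D = [set y | R x y])
          (D \in equivalence_partition R [set: T]).
Proof.
apply: (iffP imsetP) => [[x _ ->] | [x ->]]; exists x => //;
  by apply/setP => y; rewrite !inE.
Qed.

Section Blocks.
Variables (n : nat) (a : diagram n).

Lemma same_block_refl : reflexive (same_block a).
Proof.
move=> u; have /and3P [/eqP cov _ _] := diagramP a.
by rewrite /same_block mem_pblock cov inE.
Qed.

Lemma same_block_trans : transitive (same_block a).
Proof.
move=> v u w; have /and3P [_ tri _] := diagramP a.
by rewrite /same_block => /(same_pblock tri) ->.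
Qed.

Lemma block_pblock (B : {set vertex n}) u :
  B \in blocks a -> u \in B -> B = pblock a u.
Proof.
have /and3P [_ tri _] := diagramP a.
by move=> aB uB; rewrite (def_pblock tri aB uB).
Qed.

Lemma pblock_block u : pblock a u \in blocks a.
Proof.
have /and3P [/eqP cov _ _] := diagramP a.
by rewrite pblock_mem // cov inE.
Qed.

Lemma ker_sym : symmetric (ker a).
Proof.
apply: sym_connect_sym => x y.
by congr (_ || _); apply: same_block_sym.
Qed.

Lemma ker_refl : reflexive (ker a).
Proof. by move=> x; apply: connect0. Qed.

Lemma ker_trans : transitive (ker a).
Proof. exact: connect_trans. Qed.

Lemma ker_up_ker x y : same_block a (inl x) (inl y) -> ker a x y.
Proof. by move=> xy; apply: connect1; rewrite /= /ker_up xy. Qed.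

Lemma ker_low_ker x y : same_block a (inr x) (inr y) -> ker a x y.
Proof. by move=> xy; apply: connect1; rewrite /= /ker_low xy orbT. Qed.

Lemma same_ker x y : ker a x y -> ker a x =1 ker a y.
Proof. exact: (same_connect ker_sym). Qed.

Lemma kernel_classes_partition : partition (kernel_classes a) [set: 'I_n].
Proof.
apply/equivalence_partitionP => x y z _ _ _; split=> [|xy]; first exact: ker_refl.
exact: same_ker.
Qed.

Lemma kernel_type_intpart : is_intpart n (kernel_type a).
Proof.
have kP := kernel_classes_partition; apply/and3P; split.
- by apply: sort_sorted => p q; apply: leq_total.
- rewrite mem_sort; apply/mapP => -[C]; rewrite mem_enum => kC /esym/eqP.
  rewrite cards_eq0 => /eqP C0.
  by case/and3P: kP => _ _ /negP; rewrite -C0.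
- rewrite (perm_sumn (permEl (perm_sort _ _))) sumnE big_map big_enum /=.
  by rewrite -(card_partition kP) cardsT card_ord.
Qed.

Lemma size_kernel_type : size (kernel_type a) = #|kernel_classes a|.
Proof. by rewrite size_sort size_map cardE. Qed.

Lemma card_kernel_classes_le : #|kernel_classes a| <= n.
Proof.
by rewrite (leq_trans (leq_imset_card _ _)) // cardsT card_ord.
Qed.

(** * Connected components of the product graph *)

Lemma Gamma_left (b : diagram n) u v :
  same_block a u v -> Gamma a b (left_emb u) (left_emb v).
Proof.
by move=> uv; apply/existsP; exists u; apply/existsP; exists v; rewrite !eqxx uv.
Qed.

Lemma Gamma_right (b : diagram n) u v :
  same_block a u v -> Gamma b a (right_emb u) (right_emb v).
Proof.
move=> uv; apply/existsP; exists u; apply/existsP; exists v.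
by rewrite !eqxx uv orbT.
Qed.

(** The explicit description of the component of a middle vertex [x]: its
    kernel class, and the outer vertices reached from it by one edge. *)
Definition attached (x : 'I_n) (p : gvertex n) : bool :=
  match p with
  | inr y => ker a x y
  | inl (inl u) => [exists y, same_block a (inl u) (inr y) && ker a x y]
  | inl (inr u) => [exists y, same_block a (inr u) (inl y) && ker a x y]
  end.

(** When [left_emb u] lies in the middle row, the right-hand side is an indirect
    way to say that it is in the kernel class of [x]; this uniform form makes the
    closure of [attached] under edges a mere matter of transitivity. *)
Lemma attached_left x u :
  attached x (left_emb u)
    = [exists y, same_block a u (inr y) && ker a x y].
Proof.
case: u => [u|u] //=; apply/idP/existsP => [xu|[y /andP [uy xy]]].
  by exists u; rewrite same_block_refl.
by apply: ker_trans xy _; rewrite ker_sym ker_low_ker.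
Qed.

Lemma attached_right x u :
  attached x (right_emb u)
    = [exists y, same_block a u (inl y) && ker a x y].
Proof.
case: u => [u|u] //=; apply/idP/existsP => [xu|[y /andP [uy xy]]].
  by exists u; rewrite same_block_refl.
by apply: ker_trans xy _; rewrite ker_sym ker_up_ker.
Qed.

Lemma attached_step x p q : Gamma a a p q -> attached x p -> attached x q.
Proof.
move=> /existsP [u /existsP [v /orP [] /and3P [/eqP -> /eqP -> uv]]];
  rewrite ?attached_left ?attached_right => /existsP [y /andP [uy xy]];
  apply/existsP; exists y; rewrite xy andbT;
  by apply: same_block_trans uy; rewrite same_block_sym.
Qed.

Lemma ker_connect x y : ker a x y -> connect (Gamma a a) (inr x) (inr y).
Proof.
case/connectP => p; elim: p x => [|z p IH] x /=; first by move=> _ ->.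
case/andP => xz /IH{}IH /IH; apply: connect_trans; apply: connect1.
by case/orP: xz => [/(Gamma_right a)|/(Gamma_left a)].
Qed.

Lemma connect_middle x p : connect (Gamma a a) (inr x) p = attached x p.
Proof.
apply/idP/idP => [/connectP [s]|].
  have: attached x (inr x) by apply: ker_refl.
  elim: s (inr x : gvertex n) => [|q s IH] r /= xr; first by move=> _ ->.
  by case/andP => rq /IH; apply; apply: attached_step xr.
case: p => [[u|u]|y] /=; last exact: ker_connect.
  case/existsP => y /andP [uy /ker_connect xy]; apply: connect_trans xy _.
  by apply: connect1; apply: (@Gamma_left _ (inr y) (inl u)); rewrite same_block_sym.
case/existsP => y /andP [uy /ker_connect xy]; apply: connect_trans xy _.
by apply: connect1; apply: (@Gamma_right _ (inl y) (inr u)); rewrite same_block_sym.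
Qed.

End Blocks.

Lemma same_block_dprod n (a b : diagram n) u v :
  same_block (dprod a b) u v = connect (Gamma a b) (inl u) (inl v).
Proof.
rewrite /same_block pblock_equivalence_partition ?inE //.
move=> x y z _ _ _; split=> [|xy]; first exact: connect0.
exact: (same_connect (sym_connect_sym (Gamma_sym a b)) xy).
Qed.

(** * Idempotent diagrams *)

Section Idempotent.
Variables (n : nat) (a : diagram n).
Hypothesis idem : dprod a a = a.

Lemma idem_connect u v :
  connect (Gamma a a) (inl u) (inl v) = same_block a u v.
Proof. by rewrite -same_block_dprod idem. Qed.

Lemma connect_transversal_left x y :
  same_block a (inl x) (inr y) -> connect (Gamma a a) (inl (inl x)) (inr y).
Proof. by move/(Gamma_left a)/connect1. Qed.

(** A path from the top of a transversal block to its bottom crosses the middle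
    row inside one kernel class: it arrives there at the lower part of the block,
    and leaves it from the upper part of the block that it finally reaches. *)
Lemma idem_transversal_ker x y : same_block a (inl x) (inr y) -> ker a x y.
Proof.
move=> xy; have : connect (Gamma a a) (inr y) (inl (inr y)).
  apply: (@connect_trans _ _ (inl (inl x))); last by rewrite idem_connect.
  rewrite (sym_connect_sym (Gamma_sym a a)); exact: connect_transversal_left.
rewrite connect_middle => /existsP [z /andP [yz kyz]].
rewrite ker_sym; apply: ker_trans kyz _; rewrite ker_sym; apply: ker_up_ker.
exact: same_block_trans xy yz.
Qed.

(** Two transversal blocks in one kernel class would be joined in the product:
    from the top of the first through the middle row to the bottom of the
    second. *)
Lemma idem_transversal_uniq x1 y1 x2 y2 :
    same_block a (inl x1) (inr y1) -> same_block a (inl x2) (inr y2) ->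
  ker a x1 x2 -> same_block a (inl x1) (inl x2).
Proof.
move=> xy1 xy2 x12; apply: (@same_block_trans _ _ (inr y2)); last first.
  by rewrite same_block_sym.
rewrite -idem_connect; apply: connect_trans (connect_transversal_left xy1) _.
rewrite connect_middle; apply/existsP; exists x2; rewrite same_block_sym xy2.
by apply: ker_trans x12; rewrite ker_sym idem_transversal_ker.
Qed.

Definition transversal_classes : {set {set 'I_n}} :=
  [set D in kernel_classes a
     | [exists x in D, exists y, same_block a (inl x) (inr y)]].

Lemma card_transversal_classes : #|transversal_classes| = rank a.
Proof.
pose tr := [set B in blocks a | [exists x, inl x \in B] && [exists x, inr x \in B]].
(* [cl B] is the kernel class that contains the upper part of [B]; the union
   over that part avoids the choice of a vertex in it. *)
pose cl (B : {set vertex n}) := [set y | [exists x, (inl x \in B) && ker a x y]].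
have trP B : B \in tr -> exists x, exists2 y,
    same_block a (inl x) (inr y) & B = pblock a (inl x).
  rewrite inE => /and3P [aB /existsP [x xB] /existsP [y yB]].
  have eB := block_pblock aB xB.
  by exists x, y; rewrite /same_block -?eB.
have clE x : cl (pblock a (inl x)) = [set y | ker a x y].
  apply/setP => y; rewrite !inE; apply/existsP/idP => [[z /andP [xz zy]]|xy].
    exact: ker_trans (ker_up_ker xz) zy.
  by exists x; rewrite xy andbT; apply: same_block_refl.
suff -> : transversal_classes = cl @: tr.
  apply: card_in_imset => B1 B2 /trP [x1 [y1 xy1 ->]] /trP [x2 [y2 xy2 ->]].
  rewrite !clE => /setP /(_ x2); rewrite !inE ker_refl => x12.
  have /and3P [_ tri _] := diagramP a; apply/esym/same_pblock => //.
  exact: (idem_transversal_uniq xy1 xy2 x12).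
apply/setP => D; rewrite inE; apply/idP/imsetP.
  case/andP => /mem_equivalence_classes [w ->] /existsP [x /andP []].
  rewrite inE => wx /existsP [y xy]; exists (pblock a (inl x)).
    rewrite inE pblock_block /=; apply/andP; split; apply/existsP.
      by exists x; apply: same_block_refl.
    by exists y.
  by rewrite clE; apply/setP => z; rewrite !inE (same_ker wx).
case=> B /trP [x [y xy ->]] ->; rewrite clE; apply/andP; split.
  by apply/mem_equivalence_classes; exists x.
by apply/existsP; exists x; rewrite inE ker_refl; apply/existsP; exists y.
Qed.

(** A component that reaches an outer vertex does so by an edge of a transversal
    block; by [idem_transversal_ker] it makes no difference whether this block
    meets the middle row with its lower or with its upper part. *)
Lemma card_nontransversal_classes :
  #|kernel_classes a :\: transversal_classes| = floating a a.
Proof.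
pose mid (D : {set 'I_n}) : {set gvertex n} := [set inr x | x in D].
have mid_inj : injective mid by apply: imset_inj => x y [].
rewrite -(card_imset _ mid_inj); congr #|pred_of_set _|; apply/setP => C.
have midE x : C = [set p | connect (Gamma a a) (inr x) p] ->
    C \subset [set inr y | y : 'I_n] -> C = mid [set y | ker a x y].
  move=> eC /subsetP sC; apply/setP => p; apply/idP/imsetP => [pC|[y]].
    have /imsetP [y _ ep] := sC p pC; exists y => //.
    by move: pC; rewrite eC ep !inE connect_middle.
  by rewrite inE eC inE => xy ->; rewrite connect_middle.
rewrite [RHS]inE; apply/imsetP/andP.
  case=> D /setDP [] /mem_equivalence_classes [x ->].
  rewrite inE negb_and => /orP [/negP [] | ntr ->].
    by apply/mem_equivalence_classes; exists x.
  have noout u v : ker a x u -> same_block a (inl u) (inr v) -> False.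
    move=> xu uv; case/negP: ntr; apply/existsP; exists u.
    by rewrite inE xu; apply/existsP; exists v.
  split; last by apply/subsetP => _ /imsetP [y _ ->]; apply: imset_f.
  apply/mem_equivalence_classes; exists (inr x); apply/setP => p.
  rewrite inE connect_middle; apply/imsetP/idP => [[y]|].
    by rewrite inE => xy ->.
  case: p => [[u|u]|y] /=; last by exists y; rewrite ?inE.
    case/existsP => y /andP [uy xy]; case: (noout u y _ uy).
    by apply: ker_trans xy _; rewrite ker_sym idem_transversal_ker.
  case/existsP => y /andP [uy xy]; case: (noout y u xy).
  by rewrite same_block_sym.
case=> /mem_equivalence_classes [p eC] sC.
have : p \in C by rewrite eC inE connect0.
case/(subsetP sC)/imsetP => x _ ep; subst p.
exists [set y | ker a x y]; last exact: midE.
have kx : [set y | ker a x y] \in kernel_classes a.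
  by apply/mem_equivalence_classes; exists x.
apply/setDP; split=> //; rewrite inE kx /=; apply/negP => /existsP [u /andP []].
rewrite inE => xu /existsP [y uy].
have : inl (inr y) \in C.
  rewrite eC inE connect_middle; apply/existsP; exists u.
  by rewrite same_block_sym uy.
by case/(subsetP sC)/imsetP.
Qed.

Lemma rank_add_floating : rank a + floating a a = #|kernel_classes a|.
Proof.
rewrite -card_transversal_classes -card_nontransversal_classes.
have /setIidPr {1}<- : transversal_classes \subset kernel_classes a.
  by apply/subsetP => D; rewrite inE => /andP [].
exact: cardsID.
Qed.

End Idempotent.

(** * The twisted product *)

Lemma twist_orderP n (F : fieldType) (xi : F) :
  0 < twist_order n xi -> ((twist_order n xi).-primitive_root xi)%R.
Proof. by rewrite /twist_order; case: pickP. Qed.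

Lemma pmul_idemE n (F : fieldType) (xi : F) (a : diagram n) :
  (pmul xi (pbasis F a) (pbasis F a) == pbasis F a)
    = (dprod a a == a) && (xi ^+ floating a a == 1)%R.
Proof.
rewrite pmul_basis; apply/eqP/andP => [/ffunP /(_ a)|[/eqP -> /eqP ->]].
  rewrite !ffunE eqxx (eq_sym a); case: eqP => [_|_] /eqP.
    by rewrite /GRing.scale /= mulr1.
  by rewrite scaler0 eq_sym oner_eq0.
by rewrite scale1r.
Qed.

(** * Counting by fibres *)

Lemma card_sum_fibres (T : finType) (I : eqType) (s : seq I) (P : pred I)
    (A : {set T}) (f : T -> I) :
  uniq s ->
  \sum_(i <- s | P i) #|[set x in A | f x == i]|
    = #|[set x in A | (f x \in s) && P (f x)]|.
Proof.
move=> s_uniq.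
rewrite -[RHS]sum1_card (eq_bigr (fun i => \sum_(x in A) (f x == i))); last first.
  move=> i _; rewrite -sum1_card big_mkcond [RHS]big_mkcond /=.
  by apply: eq_bigr => x _; rewrite inE; case: (x \in A); case: eqP.
rewrite exchange_big /= [RHS]big_mkcond [LHS]big_mkcond /=; apply: eq_bigr => x _.
rewrite inE; case: (x \in A) => //=; rewrite big_mkcond /=.
have [fs|fs] /= := boolP (f x \in s); last first.
  rewrite big_seq big1 // => i i_s; case: eqP => [fi|_]; last by case: (P i).
  by rewrite fi i_s in fs.
rewrite (bigD1_seq (f x)) //= eqxx big1 ?addn0 // => i.
by rewrite eq_sym => /negPf ->; case: (P i).
Qed.

Theorem theorem36 (n : nat) (F : fieldType) (xi : F) (K : {set diagram n})
  (hM : 0 < twist_order n xi)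
  (hK : K = [set: diagram n] \/ K = brauer n \/ K = partial_brauer n) :
  e_xi xi K = \sum_(mu <- intparts n) e_xi_type xi mu K
  /\ forall mu : seq nat, is_intpart n mu ->
       e_xi_type xi mu K
       = \sum_(0 <= r < n.+1 | r == size mu %[mod twist_order n xi])
           e_type mu (rank_class r K).
Proof.
split=> [|mu _].
  pose A := [set a in K | pmul xi (pbasis F a) (pbasis F a) == pbasis F a].
  transitivity #|[set a in A | (kernel_type a \in intparts n) && true]|.
    apply: eq_card => a.
    by rewrite !inE mem_intparts kernel_type_intpart !andbT.
  rewrite -(card_sum_fibres predT A _ (intparts_uniq n)).
  by apply: eq_bigr => mu _; apply: eq_card => a; rewrite !inE -andbA.
pose A := [set a in K | (dprod a a == a) && (kernel_type a == mu)].
rewrite (eq_bigr (fun r => #|[set a in A | rank a == r]|)); last first.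
  by move=> r _; apply: eq_card => a; rewrite !inE andbAC.
rewrite card_sum_fibres ?iota_uniq //; apply: eq_card => a.
rewrite inE pmul_idemE [RHS]inE [a \in A]inE -!andbA; congr (_ && _).
have [idem|//] /= := eqP; rewrite andbC; have [<-|//] /= := eqP.
have rf := rank_add_floating idem.
have rank_le : rank a <= #|kernel_classes a| by rewrite -rf leq_addr.
rewrite mem_index_iota ltnS (leq_trans rank_le (card_kernel_classes_le a)) /=.
(* As rank a <= k, the congruence modulo M says that M divides k - rank a, and
   this difference is the number of floating components. *)
rewrite size_kernel_type [RHS]eq_sym eqn_mod_dvd // -rf addKn.
by rewrite (prim_order_dvd (twist_orderP hM)).
Qed.
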